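(* Let $C$ be a real symmetric positive-semidefinite matrix of order $n$ and let $0<s<n$ be an integer with $s=\operatorname{rank}(C)$. Write $C=Q\Lambda Q^\top$, where $Q$ is orthogonal and $\Lambda=\operatorname{Diag}(\lambda_1,\dots,\lambda_n)$ with $\lambda_1\ge\cdots\ge\lambda_s>\lambda_{s+1}=\cdots=\lambda_n=0$, and let $\Lambda_s:=\operatorname{Diag}(\lambda_1,\dots,\lambda_s)$. For $x\in\mathbb{R}^n$ let $P=P(x):=Q^\top\operatorname{Diag}(x)Q$, let $P_s$ be the principal submatrix of $P$ indexed by $(1,\dots,s)$, and let $P_{n-s}$ be the principal submatrix of $P$ indexed by $(s+1,\dots,n)$. Then $\lim_{\gamma\to+\infty}\operatorname{linx}(C,s;\gamma)$ exists and is the optimal value of the following convex program: $$\max\ \tfrac12\Big(\operatorname{ldet}(\Lambda_sP_s\Lambda_s)+\operatorname{ldet}(I_{n-s}-P_{n-s})\Big)\quad\text{s.t.}\quad \mathbf{e}^\top x=s,\ 0\le x\le\mathbf{e}.$$ Furthermore, $\operatorname{linx}(C,s;\gamma)$ is monotonically non-increasing in $\gamma$ (on $\gamma>0$).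
   Context: Notation: $\mathbf{e}$ is the all-ones vector in $\mathbb{R}^n$; $\operatorname{Diag}(x)$ is the diagonal matrix with diagonal $x$; $I_k$ is the identity matrix of order $k$; $\operatorname{ldet}$ is the natural logarithm of the determinant (with value $-\infty$ if the determinant is $0$). For a real symmetric positive-semidefinite matrix $C$ of order $n$, an integer $0<s<n$ and $\gamma>0$, the scaled linx bound is $$\operatorname{linx}(C,s;\gamma):=\max\left\{\tfrac12\Big(\operatorname{ldet}\big(\gamma C\operatorname{Diag}(x)C+\operatorname{Diag}(\mathbf{e}-x)\big)-s\log\gamma\Big): x\in\mathbb{R}^n,\ \mathbf{e}^\top x=s,\ 0\le x\le\mathbf{e}\right\}.$$ *)

(* Defs.v *)
From mathcomp Require Export all_boot all_order all_algebra.
From mathcomp Require Export all_classical all_reals all_analysis.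
Export Order.TTheory GRing.Theory Num.Theory numFieldNormedType.Exports.

Set Implicit Arguments.
Unset Strict Implicit.
Unset Printing Implicit Defensive.

Local Open Scope classical_set_scope.
Local Open Scope ring_scope.

Definition possemidef (R : realType) (n : nat) (A : 'M[R]_n) : Prop :=
  A^T = A /\ forall v : 'cV[R]_n, 0 <= (v^T *m A *m v) 0 0.

(* [lne] is -oo at 0 (and at negative reals, which do not occur as
   determinants of the positive-semidefinite matrices considered here). *)
Definition ldet (R : realType) (n : nat) (A : 'M[R]_n) : \bar R :=
  lne (\det A)%:E.

Definition feasible (R : realType) (n s : nat) : set 'rV[R]_n :=
  [set x | \sum_i x 0 i = s%:R /\ forall i, 0 <= x 0 i <= 1].
Arguments feasible R n s : clear implicits.

Definition is_max (R : realType) (T : Type) (D : set T) (f : T -> \bar R)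
    (v : \bar R) : Prop :=
  (f @` D) v /\ ubound (f @` D) v.

(* In [\bar R], 0 * -oo = 0, so the cases t = 0 and t = 1 are trivial. *)
Definition concave_on (R : realType) (n : nat) (D : set 'rV[R]_n)
    (f : 'rV[R]_n -> \bar R) : Prop :=
  forall (x y : 'rV[R]_n) (t : R), D x -> D y -> 0 <= t <= 1 ->
    (t%:E * f x + (1 - t)%:E * f y <= f (t *: x + (1 - t) *: y)%R)%E.

(* The program of maximizing [f] over [D] is convex. *)
Definition convex_program (R : realType) (n : nat) (D : set 'rV[R]_n)
    (f : 'rV[R]_n -> \bar R) : Prop :=
  @convex_set R 'rV[R]_n D /\ concave_on D f.

Definition linx_obj (R : realType) (n : nat) (C : 'M[R]_n) (s : nat)
    (gamma : R) (x : 'rV[R]_n) : \bar R :=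
  ((2^-1)%:E * (ldet (gamma *: (C *m diag_mx x *m C)
                      + diag_mx (const_mx 1 - x))%R
                - (s%:R * ln gamma)%:E))%E.

(* The maximum is written as a supremum to make [linx] a total function. *)
Definition linx (R : realType) (n : nat) (C : 'M[R]_n) (s : nat)
    (gamma : R) : \bar R :=
  ereal_sup (linx_obj C s gamma @` feasible R n s).

(* The indices s, ..., n - 1 (counting from 0). *)
Definition trail_ord (n s : nat) (h : (s <= n)%N) (j : 'I_(n - s)) : 'I_n :=
  cast_ord (subnKC h) (rshift s j).

Definition lead_submx (R : realType) (n s : nat) (h : (s <= n)%N)
    (A : 'M[R]_n) : 'M[R]_s :=
  mxsub (widen_ord h) (widen_ord h) A.

Definition trail_submx (R : realType) (n s : nat) (h : (s <= n)%N)
    (A : 'M[R]_n) : 'M[R]_(n - s) :=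
  mxsub (trail_ord h) (trail_ord h) A.

Definition limit_obj (R : realType) (n s : nat) (h : (s <= n)%N)
    (Q : 'M[R]_n) (lambda : 'rV[R]_n) (x : 'rV[R]_n) : \bar R :=
  let Lambda_s := diag_mx (colsub (widen_ord h) lambda) in
  let P := Q^T *m diag_mx x *m Q in
  ((2^-1)%:E * (ldet (Lambda_s *m lead_submx h P *m Lambda_s)
                + ldet (1%:M - trail_submx h P)%R))%E.

(* Main.v *)
Require Import Defs.
From mathcomp Require Import ring lra.

Set Implicit Arguments.
Unset Strict Implicit.
Unset Printing Implicit Defensive.

Local Open Scope classical_set_scope.
Local Open Scope ring_scope.

(** Conjugating by [Q] turns gamma C Diag(x) C + Diag(e - x) into
    gamma Lambda P Lambda + (I - P), and Lambda P Lambda is supported on the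
    leading s x s block, where it equals A := Lambda_s P_s Lambda_s.  Write
    E, F, F^T, G for the blocks of S := I - P, so that G = I - P_{n-s}.
    Dividing the first s rows by gamma and putting t := 1 / gamma gives
      gamma^(-s) det (gamma C Diag(x) C + Diag(e - x)) = D(t, x),
    where D(t, x) := det [A + t E, t F; F^T, G].  Hence the objective of linx is
    log D(1 / gamma, x) / 2.  At t = 0 the matrix is block triangular, so that
    D(0, x) = det A det G, and log D(0, x) / 2 is the objective of the limit
    program: passing to the limit gamma -> +oo is putting t = 0.

    Monotonicity holds for each fixed x.  Eliminating G gives
    D(t, x) = det G det (A + t (E - F G^-1 F^T)), where A and the Schur
    complement of S are positive semidefinite, and the determinant is
    nondecreasing in the Loewner order ([det_le_psdD]); when G is singular,
    D(t, x) = 0 for all t ([det_pencil_eq0]).  This is [det_pencil_mono].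

    For the limit, let m(t) be the maximum of D(t, .) over the compact feasible
    set.  Monotonicity gives m(0) <= m(t); conversely D is jointly continuous,
    so that by compactness D(t, .) < M on the whole feasible set for all small t
    as soon as D(0, .) < M there ([near_scaled_det_lt]).  Moreover m(0) > 0, as
    the point x = (s / n) e shows, so the limit is a finite number.

    Concavity of the limit objective is the concavity of log det on positive
    semidefinite matrices ([ln_det_concave]).  That fact and the Loewner
    monotonicity of det are both obtained by peeling off one row and column at
    a time: the pivot is the minimum of the quadratic form over the vectors with
    first entry 1 ([psd_pivot]), hence a superadditive and concave function of
    the matrix. *)

(** * Positive-semidefinite matrices *)

Definition qform (R : realType) n (A : 'M[R]_n) (v : 'cV[R]_n) : R :=
  (v^T *m A *m v) 0 0.

Section PosSemiDef.
Variable R : realType.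

Lemma qformDl n (A B : 'M[R]_n) v : qform (A + B) v = qform A v + qform B v.
Proof. by rewrite /qform mulmxDr mulmxDl mxE. Qed.

Lemma qformZl n (A : 'M[R]_n) c v : qform (c *: A) v = c * qform A v.
Proof. by rewrite /qform -scalemxAr -scalemxAl mxE. Qed.

Lemma qform_congr m n (A : 'M[R]_m) (B : 'M[R]_(m, n)) v :
  qform (B^T *m A *m B) v = qform A (B *m v).
Proof. by rewrite /qform trmx_mul !mulmxA. Qed.

Lemma qform_diag n (x : 'rV[R]_n) v :
  qform (diag_mx x) v = \sum_i x 0 i * v i 0 ^+ 2.
Proof.
by rewrite /qform mul_mx_diag !mxE; apply: eq_bigr => i _; rewrite !mxE; ring.
Qed.

Lemma psdD n (A B : 'M[R]_n) :
  possemidef A -> possemidef B -> possemidef (A + B).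
Proof.
move=> [sA pA] [sB pB]; split=> [|v]; first by rewrite linearD /= sA sB.
by rewrite -/(qform _ _) qformDl addr_ge0 ?pA ?pB.
Qed.

Lemma psdZ n (A : 'M[R]_n) c : 0 <= c -> possemidef A -> possemidef (c *: A).
Proof.
move=> c0 [sA pA]; split=> [|v]; first by rewrite linearZ /= sA.
by rewrite -/(qform _ _) qformZl mulr_ge0 ?pA.
Qed.

Lemma psd_congr m n (A : 'M[R]_m) (B : 'M[R]_(m, n)) :
  possemidef A -> possemidef (B^T *m A *m B).
Proof.
move=> [sA pA]; split=> [|v]; first by rewrite !trmx_mul trmxK sA mulmxA.
by rewrite -/(qform _ _) qform_congr pA.
Qed.

Lemma psd_diag n (x : 'rV[R]_n) :
  (forall i, 0 <= x 0 i) -> possemidef (diag_mx x).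
Proof.
move=> x0; split=> [|v]; first exact: tr_diag_mx.
rewrite -/(qform _ _) qform_diag; apply: sumr_ge0 => i _.
by rewrite mulr_ge0 ?sqr_ge0.
Qed.

Lemma psd_mxsub m n (f : 'I_m -> 'I_n) (A : 'M[R]_n) :
  possemidef A -> possemidef (mxsub f f A).
Proof.
have -> : mxsub f f A = (colsub f 1%:M)^T *m A *m colsub f 1%:M.
  by rewrite trmx_mxsub trmx1 mul_rowsub_mx mul1mx mulmx_colsub mulmx1 -mxsubcr.
exact: psd_congr.
Qed.

(** The quadratic form is nonnegative along the line v + c A v, on which it is
    2 c |A v|^2 + c^2 (A v)^T A (A v); this is impossible for small c < 0
    unless A v = 0. *)
Lemma psd_ker n (A : 'M[R]_n) v : possemidef A -> qform A v = 0 -> A *m v = 0.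
Proof.
move=> [sA pA] qv; set w := A *m v.
have wA : v^T *m A = w^T by rewrite trmx_mul sA.
pose a : R := (w^T *m w) 0 0; pose b := qform A w.
have b_ge0 : 0 <= b by exact: pA.
have expand c : qform A (v + c *: w) = 2 * c * a + c ^+ 2 * b.
  have -> : qform A (v + c *: w) = qform A v + c * (w^T *m A *m v) 0 0
      + c * (v^T *m A *m w) 0 0 + c ^+ 2 * b.
    rewrite /b /qform [(v + _)^T]linearD /= [(c *: w)^T]linearZ /=.
    rewrite !mulmxDl !mulmxDr -!scalemxAl -!scalemxAr !mxE; ring.
  by rewrite qv wA -mulmxA -/w -/a; ring.
(* c = - a / (b + 1) makes the bound explicit and also covers b = 0. *)
have a0 : a = 0.
  have := pA (v - (a / (b + 1)) *: w); rewrite -/(qform _ _) -scaleNr expand.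
  have b1 : b + 1 != 0 by rewrite gt_eqF // ltr_wpDl.
  have -> : 2 * - (a / (b + 1)) * a + (- (a / (b + 1))) ^+ 2 * b
          = - ((a / (b + 1)) ^+ 2 * (b + 2)) by field.
  rewrite oppr_ge0 pmulr_lle0 ?ltr_wpDl // => h.
  have : (a / (b + 1)) ^+ 2 == 0 by rewrite eq_le h sqr_ge0.
  by rewrite sqrf_eq0 mulf_eq0 invr_eq0 (negPf b1) orbF => /eqP.
have : \sum_i w i 0 ^+ 2 = 0.
  by rewrite -[RHS]a0 /a [RHS]mxE; apply: eq_bigr => i _; rewrite [w^T _ _]mxE.
move=> /psumr_eq0P h; apply/matrixP => i j; rewrite ord1 [RHS]mxE; apply/eqP.
by rewrite -sqrf_eq0 h // => k _; exact: sqr_ge0.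
Qed.

(** * Schur complements and pivots *)

Definition schur m n (M : 'M[R]_(m + n)) : 'M[R]_m :=
  ulsubmx M - ursubmx M *m invmx (drsubmx M) *m dlsubmx M.

Lemma schur_factor m n (M : 'M[R]_(m + n)) : drsubmx M \in unitmx ->
  M = block_mx 1%:M (ursubmx M *m invmx (drsubmx M)) 0 1%:M
      *m block_mx (schur M) 0 0 (drsubmx M)
      *m block_mx 1%:M 0 (invmx (drsubmx M) *m dlsubmx M) 1%:M.
Proof.
move=> G1; rewrite !mulmx_block !(mul0mx, mulmx0, mul1mx, mulmx1, add0r, addr0).
by rewrite mulmxKV // mulKVmx // mulmxA subrK submxK.
Qed.

Lemma det_schur m n (M : 'M[R]_(m + n)) : drsubmx M \in unitmx ->
  \det M = \det (schur M) * \det (drsubmx M).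
Proof.
move=> G1; rewrite [in LHS](schur_factor G1) !det_mulmx !det_ublock det_lblock.
by rewrite !det1 !mul1r !mulr1.
Qed.

Lemma psd_submx m n (M : 'M[R]_(m + n)) : possemidef M ->
  possemidef (drsubmx M) /\ (ursubmx M)^T = dlsubmx M.
Proof.
move=> pM; split; first by rewrite drsubmxEsub; exact: psd_mxsub.
by rewrite trmx_ursub pM.1.
Qed.

(** Completing the square in the trailing variables: the Schur complement is the
    minimum of the quadratic form over them. *)
Lemma qform_schur m n (M : 'M[R]_(m + n)) w v :
  possemidef M -> drsubmx M \in unitmx ->
  qform M (col_mx w v) = qform (schur M) w
    + qform (drsubmx M) (v + invmx (drsubmx M) *m dlsubmx M *m w).
Proof.
move=> pM G1; have [pG tF] := psd_submx pM.
rewrite [in LHS](schur_factor G1); set U := block_mx _ _ (_ *m dlsubmx M) _.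
have -> : block_mx 1%:M (ursubmx M *m invmx (drsubmx M)) 0 1%:M = U^T.
  by rewrite tr_block_mx !trmx1 trmx0 trmx_mul trmx_inv pG.1 -tF trmxK.
rewrite qform_congr mul_block_col !mul1mx mul0mx addr0 [_ + v]addrC.
rewrite /qform tr_col_mx mul_row_block !mulmx0 addr0 add0r mul_row_col.
by rewrite mxE.
Qed.

Lemma qform_schur_le m n (M : 'M[R]_(m + n)) w v :
  possemidef M -> drsubmx M \in unitmx ->
  qform (schur M) w <= qform M (col_mx w v).
Proof.
move=> pM G1; rewrite qform_schur // lerDl; exact: (psd_submx pM).1.2.
Qed.

Lemma qform_schur_attained m n (M : 'M[R]_(m + n)) w :
  possemidef M -> drsubmx M \in unitmx ->
  exists v, qform (schur M) w = qform M (col_mx w v).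
Proof.
move=> pM G1; exists (- (invmx (drsubmx M) *m dlsubmx M *m w)).
by rewrite qform_schur // addNr /qform mulmx0 [X in _ + X]mxE addr0.
Qed.

Lemma psd_schur m n (M : 'M[R]_(m + n)) :
  possemidef M -> drsubmx M \in unitmx -> possemidef (schur M).
Proof.
move=> pM G1; have [pG tF] := psd_submx pM; split=> [|w].
  rewrite /schur linearB /= !trmx_mul trmx_inv pG.1 trmx_ulsub pM.1 -tF trmxK.
  by rewrite mulmxA.
have [v] := qform_schur_attained w pM G1; rewrite /qform => ->; exact: pM.2.
Qed.

(** Equals diag(t I_m, I_n) (diag(A / t, 0) + S) for t != 0; unlike that product
    it makes sense at t = 0. *)
Definition pencil m n (A : 'M[R]_m) (S : 'M[R]_(m + n)) (t : R) :
    'M[R]_(m + n) :=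
  block_mx (A + t *: ulsubmx S) (t *: ursubmx S) (dlsubmx S) (drsubmx S).

Lemma pencil01 m n (S : 'M[R]_(m + n)) : pencil 0 S 1 = S.
Proof. by rewrite /pencil add0r !scale1r submxK. Qed.

Lemma unitmx_det_neq0 n (A : 'M[R]_n) : (A \in unitmx) = (\det A != 0).
Proof. by rewrite unitmxE unitfE. Qed.

(** A kernel vector v of the trailing block satisfies S (0, v) = 0 by [psd_ker],
    so that (0, v) is also in the kernel of the pencil.  The case of [S] itself
    is t = 1 with A = 0. *)
Lemma det_pencil_eq0 m n (A : 'M[R]_m) (S : 'M[R]_(m + n)) t :
  possemidef S -> \det (drsubmx S) = 0 -> \det (pencil A S t) = 0.
Proof.
move=> pS /eqP/det0P [u u0 uG]; have [pG tF] := psd_submx pS.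
have Gu : drsubmx S *m u^T = 0 by rewrite -[drsubmx S]pG.1 -trmx_mul uG trmx0.
have /(psd_ker pS) : qform S (col_mx 0 u^T) = 0.
  rewrite /qform tr_col_mx -[X in _ *m X *m _]submxK mul_row_block trmx0.
  by rewrite !mul0mx mul_row_col mulmx0 !add0r trmxK uG mul0mx mxE.
rewrite -[S in S *m _]submxK mul_block_col !mulmx0 !add0r => /eqP.
rewrite col_mx_eq0 => /andP[/eqP Fu _].
rewrite -det_tr; apply/eqP/det0P; exists (row_mx 0 u).
  by rewrite row_mx_eq0 negb_and u0 orbT.
apply: trmx_inj; rewrite trmx_mul trmxK trmx0 tr_row_mx trmx0 mul_block_col.
by rewrite !mulmx0 -scalemxAl Fu Gu scaler0 !addr0 col_mx0.
Qed.

Lemma psd_det_eq0_dr m n (S : 'M[R]_(m + n)) :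
  possemidef S -> \det (drsubmx S) = 0 -> \det S = 0.
Proof. by move=> pS /(det_pencil_eq0 0 1 pS); rewrite pencil01. Qed.

(** The variational description of the pivot: being a minimum of linear
    functions of [M], it is superadditive and concave in [M].  This drives the
    inductions of [det_le_psdD] and [ln_det_concave]. *)
Lemma psd_pivot n (M : 'M[R]_(1 + n)) :
  possemidef M -> drsubmx M \in unitmx ->
  [/\ \det M = qform (schur M) 1%:M * \det (drsubmx M),
      0 <= qform (schur M) 1%:M
   & (forall v, qform (schur M) 1%:M <= qform M (col_mx 1%:M v)) /\
     exists v, qform (schur M) 1%:M = qform M (col_mx 1%:M v)].
Proof.
move=> pM G1; split.
- by rewrite det_schur // det_mx11 /qform trmx1 mul1mx mulmx1.
- exact: (psd_schur pM G1).2.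
- split=> [v|]; [exact: qform_schur_le|exact: qform_schur_attained].
Qed.

Lemma psd_det_ge0 n (A : 'M[R]_n) : possemidef A -> 0 <= \det A.
Proof.
elim: n A => [A _|n IH]; first by rewrite det_mx00.
rewrite -[n.+1]/(1 + n)%N => A pA.
have [pG _] := psd_submx pA.
have [G0|G1] := eqVneq (\det (drsubmx A)) 0.
  by rewrite (psd_det_eq0_dr pA G0).
rewrite -unitmx_det_neq0 in G1; have [-> s0 _] := psd_pivot pA G1.
by rewrite mulr_ge0 // IH.
Qed.

(** * Monotonicity and concavity of the determinant *)

(** Neither the pivot nor, by induction, the trailing minor decreases when [B]
    is added. *)
Lemma det_le_psdD n (A B : 'M[R]_n) :
  possemidef A -> possemidef B -> \det A <= \det (A + B).
Proof.
elim: n A B => [A B _ _|n IH]; first by rewrite !det_mx00.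
rewrite -[n.+1]/(1 + n)%N => A B pA pB.
have pC := psdD pA pB.
have [pGA _] := psd_submx pA; have [pGB _] := psd_submx pB.
have GC : drsubmx (A + B) = drsubmx A + drsubmx B.
  by apply/matrixP => i j; rewrite !mxE.
have := IH _ _ pGA pGB; rewrite -GC => leG.
have [GA0|GA1] := eqVneq (\det (drsubmx A)) 0.
  by rewrite (psd_det_eq0_dr pA GA0) psd_det_ge0.
have GA_gt0 : 0 < \det (drsubmx A).
  by rewrite lt_def GA1 psd_det_ge0.
have GC1 : drsubmx (A + B) \in unitmx.
  by rewrite unitmx_det_neq0 gt_eqF // (lt_le_trans GA_gt0).
rewrite -unitmx_det_neq0 in GA1.
have [-> sA0 [minA _]] := psd_pivot pA GA1.
have [-> sC0 [_ [v eC]]] := psd_pivot pC GC1.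
apply: ler_pM => //; first exact: ltW.
by rewrite eC [leRHS]qformDl (le_trans (minA v)) // lerDl; exact: pB.2.
Qed.

Lemma ln_conv_le (t a b : R) : 0 < t < 1 -> 0 < a -> 0 < b ->
  t * ln a + (1 - t) * ln b <= ln (t * a + (1 - t) * b).
Proof.
move=> /andP[t0 t1] a0 b0.
have := @concave_ln _ (Itv01 (ltW t0) (ltW t1)) _ _ a0 b0.
by rewrite !convRE.
Qed.

(** ln det A is the sum of the logarithms of the pivots, and each pivot is a
    concave function of the matrix. *)
Lemma ln_det_concave n (A B : 'M[R]_n) t : 0 < t < 1 ->
  possemidef A -> possemidef B -> 0 < \det A -> 0 < \det B ->
  0 < \det (t *: A + (1 - t) *: B) /\
  t * ln (\det A) + (1 - t) * ln (\det B) <= ln (\det (t *: A + (1 - t) *: B)).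
Proof.
move=> t01; have [t0 t1] := andP t01; have t1' : 0 < 1 - t by rewrite subr_gt0.
elim: n A B => [A B _ _ _ _|n IH].
  by rewrite !det_mx00 ln1 !mulr0 addr0.
rewrite -[n.+1]/(1 + n)%N => A B pA pB dA dB.
have [pGA _] := psd_submx pA; have [pGB _] := psd_submx pB.
set C := t *: A + _.
have pC : possemidef C by apply: psdD; apply: psdZ => //; exact: ltW.
have GC : drsubmx C
    = t *: drsubmx A + (1 - t) *: drsubmx B.
  by apply/matrixP => i j; rewrite !mxE.
have pos (M : 'M[R]_(1 + n)) :
    possemidef M -> 0 < \det M -> 0 < \det (drsubmx M).
  move=> pM dM; rewrite lt_def psd_det_ge0 ?andbT; last exact: (psd_submx pM).1.
  by apply: contraTneq dM => /(psd_det_eq0_dr pM) ->; rewrite ltxx.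
have gA := pos _ pA dA; have gB := pos _ pB dB.
have [gC leG] := IH _ _ pGA pGB gA gB; rewrite -GC in gC leG.
have unit (M : 'M[R]_(1 + n)) : 0 < \det (drsubmx M) -> drsubmx M \in unitmx.
  by rewrite unitmx_det_neq0 => /gt_eqF ->.
have [eA sA0 [minA _]] := psd_pivot pA (unit _ gA).
have [eB sB0 [minB _]] := psd_pivot pB (unit _ gB).
have [eC sC0 [_ [v vC]]] := psd_pivot pC (unit _ gC).
have sA : 0 < qform (schur A) 1%:M.
  by rewrite -(pmulr_lgt0 _ gA) -eA.
have sB : 0 < qform (schur B) 1%:M.
  by rewrite -(pmulr_lgt0 _ gB) -eB.
have leS : t * qform (schur A) 1%:M
   + (1 - t) * qform (schur B) 1%:M <= qform (schur C) 1%:M.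
  by rewrite vC /C [leRHS]qformDl !qformZl lerD // ler_pM2l.
have sC : 0 < qform (schur C) 1%:M.
  by apply: lt_le_trans leS; rewrite addr_gt0 // mulr_gt0.
rewrite eA eB eC; split; first exact: mulr_gt0.
rewrite !lnM ?posrE //.
have := ln_conv_le t01 sA sB.
have : ln (t * qform (schur A) 1%:M
   + (1 - t) * qform (schur B) 1%:M) <= ln (qform (schur C) 1%:M).
  by rewrite ler_ln // posrE // addr_gt0 // mulr_gt0.
rewrite !mulrDr; lra.
Qed.

(** * The pencil as a function of its parameter *)

Lemma det_pencil0 m n (A : 'M[R]_m) (S : 'M[R]_(m + n)) :
  \det (pencil A S 0) = \det A * \det (drsubmx S).
Proof. by rewrite /pencil !scale0r addr0 det_lblock. Qed.

Lemma det_pencil_scale m n (A : 'M[R]_m) (S : 'M[R]_(m + n)) c : c != 0 ->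
  \det (block_mx (c *: A) 0 0 0 + S) = c ^+ m * \det (pencil A S c^-1).
Proof.
move=> c0.
have -> : block_mx (c *: A) 0 0 0 + S
        = block_mx c%:M 0 0 1%:M *m pencil A S c^-1.
  rewrite -[S in LHS]submxK add_block_mx /pencil mulmx_block.
  rewrite !mul_scalar_mx !mul0mx !addr0 ?scale1r !add0r scalerDr !scalerA.
  by rewrite divff // !scale1r.
by rewrite det_mulmx det_ublock det_scalar det1 mulr1.
Qed.

(** Eliminating the trailing block leaves A + t times the Schur complement of
    [S], which grows with t in the Loewner order. *)
Lemma det_pencil_mono m n (A : 'M[R]_m) (S : 'M[R]_(m + n)) t u :
  possemidef A -> possemidef S -> 0 <= t -> t <= u ->
  0 <= \det (pencil A S t) <= \det (pencil A S u).
Proof.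
move=> pA pS t0 tu; have [pG _] := psd_submx pS.
have [G0|G1] := eqVneq (\det (drsubmx S)) 0.
  by rewrite !det_pencil_eq0 // lexx.
rewrite -unitmx_det_neq0 in G1.
have detE r : \det (pencil A S r) = \det (A + r *: schur S) * \det (drsubmx S).
  rewrite det_schur /schur block_mxKdr // block_mxKul block_mxKur block_mxKdl.
  by rewrite -!scalemxAl scalerBr addrA.
have pC : possemidef (A + t *: schur S).
  by apply: psdD => //; apply: psdZ => //; exact: psd_schur.
rewrite !detE mulr_ge0 ?psd_det_ge0 //= ler_wpM2r ?psd_det_ge0 //.
have -> : A + u *: schur S = (A + t *: schur S) + (u - t) *: schur S.
  by rewrite -addrA -scalerDl [t + _]addrC subrK.
by apply: det_le_psdD => //; apply: psdZ; [rewrite subr_ge0|exact: psd_schur].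
Qed.
End PosSemiDef.

(** * The objectives of linx and of the limit program *)

Lemma det_mxsub_cast (R : comNzRingType) m n (e : m = n) (A : 'M[R]_n) :
  \det (mxsub (cast_ord e) (cast_ord e) A) = \det A.
Proof.
by case: _ / e in A *; rewrite (mxsub_eq_id (cast_ord_id _) (cast_ord_id _)).
Qed.

Definition lead_LPL (R : realType) (n s : nat) (h : (s <= n)%N)
    (Q : 'M[R]_n) (lambda x : 'rV[R]_n) : 'M[R]_s :=
  let Lambda_s := diag_mx (colsub (widen_ord h) lambda) in
  Lambda_s *m lead_submx h (Q^T *m diag_mx x *m Q) *m Lambda_s.

(** I - P, reindexed along n = s + (n - s) so that its trailing block is
    I - P_{n-s}. *)
Definition compl_P (R : realType) (n s : nat) (h : (s <= n)%N)
    (Q : 'M[R]_n) (x : 'rV[R]_n) : 'M[R]_(s + (n - s)) :=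
  mxsub (cast_ord (subnKC h)) (cast_ord (subnKC h))
    (1%:M - Q^T *m diag_mx x *m Q).

(** gamma^(-s) det (gamma C Diag(x) C + Diag(e - x)) in the variable
    t = 1 / gamma, extended to t = 0; see [det_linx]. *)
Definition scaled_det (R : realType) (n s : nat) (h : (s <= n)%N)
    (Q : 'M[R]_n) (lambda : 'rV[R]_n) (t : R) (x : 'rV[R]_n) : R :=
  \det (pencil (lead_LPL h Q lambda x) (compl_P h Q x) t).

Section Spectral.
Variables (R : realType) (n s : nat) (h : (s <= n)%N).
Variables (C Q : 'M[R]_n) (lambda : 'rV[R]_n).
Hypotheses (Q_orth : Q^T *m Q = 1%:M) (C_spec : C = Q *m diag_mx lambda *m Q^T).
Hypothesis lambda_zero : forall i : 'I_n, (s <= i)%N -> lambda 0 i = 0.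

Lemma lead_LPLE x i j : lead_LPL h Q lambda x i j =
  lambda 0 (widen_ord h i)
  * (Q^T *m diag_mx x *m Q) (widen_ord h i) (widen_ord h j)
  * lambda 0 (widen_ord h j).
Proof.
rewrite /lead_LPL; move: (_ *m Q) => P.
by rewrite mul_mx_diag mul_diag_mx !mxE.
Qed.

Lemma drsubmx_compl_P x : drsubmx (compl_P h Q x)
  = 1%:M - trail_submx h (Q^T *m diag_mx x *m Q).
Proof.
rewrite drsubmxEsub /compl_P; move: (_ *m Q) => P; apply/matrixP => i j.
rewrite !mxE; congr (_%:R - _).
by rewrite (inj_eq (@cast_ord_inj _ _ _)) (inj_eq (@rshift_inj _ _)).
Qed.

(** The rows and columns of Lambda P Lambda of index at least s vanish, so that
    gamma can be factored out of exactly s rows. *)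
Lemma det_linx gamma x : gamma != 0 ->
  \det (gamma *: (C *m diag_mx x *m C) + diag_mx (const_mx 1 - x))
  = gamma ^+ s * scaled_det h Q lambda gamma^-1 x.
Proof.
move=> g0; rewrite /scaled_det -det_pencil_scale //.
set P := Q^T *m diag_mx x *m Q; set D := diag_mx lambda.
have QtC : Q^T *m C = D *m Q^T by rewrite C_spec !mulmxA Q_orth mul1mx.
have CQ : C *m Q = Q *m D by rewrite C_spec -!mulmxA Q_orth mulmx1.
set M := gamma *: _ + _.
have QMQ : Q^T *m M *m Q = gamma *: (D *m P *m D) + (1%:M - P).
  rewrite /M mulmxDr mulmxDl -scalemxAr -scalemxAl; congr (_ *: _ + _).
    by rewrite !mulmxA QtC -!mulmxA CQ.
  by rewrite linearB /= diag_const_mx mulmxBr mulmxBl mulmx1 Q_orth.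
have -> : \det M = \det (Q^T *m M *m Q).
  by rewrite !det_mulmx mulrAC -det_mulmx Q_orth det1 mul1r.
rewrite QMQ -(det_mxsub_cast (subnKC h)); congr (\det _).
rewrite linearD /=; congr (_ + _).
have tail (i : 'I_(n - s)) : lambda 0 (cast_ord (subnKC h) (rshift s i)) = 0.
  by apply: lambda_zero => /=; rewrite leq_addr.
have lead (i : 'I_s) : cast_ord (subnKC h) (lshift (n - s) i) = widen_ord h i.
  exact: val_inj.
rewrite /lead_LPL -/P; clearbody P.
rewrite !mul_mx_diag !mul_diag_mx; apply/matrixP => i j; rewrite [LHS]mxE.
case: (split_ordP i) => i' ->; case: (split_ordP j) => j' ->.
- by rewrite block_mxEul !lead !mxE.
- by rewrite block_mxEur !mxE tail !mulr0.
- by rewrite block_mxEdl !mxE tail !mul0r mulr0.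
- by rewrite block_mxEdr !mxE tail !mul0r mulr0.
Qed.

Lemma scaled_det0 x : scaled_det h Q lambda 0 x =
  \det (lead_LPL h Q lambda x)
  * \det (1%:M - trail_submx h (Q^T *m diag_mx x *m Q)).
Proof. by rewrite /scaled_det det_pencil0 drsubmx_compl_P. Qed.

Lemma psd_lead_LPL x : feasible R n s x -> possemidef (lead_LPL h Q lambda x).
Proof.
move=> [_ x01]; rewrite /lead_LPL; set L := diag_mx _.
rewrite -[X in X *m lead_submx _ _]tr_diag_mx.
apply/psd_congr/psd_mxsub/psd_congr/psd_diag.
by move=> i; case/andP: (x01 i).
Qed.

Lemma psd_compl_P x : feasible R n s x -> possemidef (compl_P h Q x).
Proof.
move=> [_ x01]; apply/psd_mxsub.
have -> : 1%:M - Q^T *m diag_mx x *m Q = Q^T *m diag_mx (const_mx 1 - x) *m Q.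
  by rewrite linearB /= diag_const_mx mulmxBr mulmxBl mulmx1 Q_orth.
by apply/psd_congr/psd_diag => i; rewrite !mxE subr_ge0; case/andP: (x01 i).
Qed.

Lemma scaled_det_mono x t u : feasible R n s x -> 0 <= t -> t <= u ->
  0 <= scaled_det h Q lambda t x <= scaled_det h Q lambda u x.
Proof.
by move=> xf; apply: det_pencil_mono; [exact: psd_lead_LPL|exact: psd_compl_P].
Qed.

Lemma linx_objE gamma x : feasible R n s x -> 0 < gamma ->
  linx_obj C s gamma x
  = ((2^-1)%:E * lne (scaled_det h Q lambda gamma^-1 x)%:E)%E.
Proof.
move=> xf g0; rewrite /linx_obj /ldet det_linx ?gt_eqF //; congr (_ * _)%E.
have /(scaled_det_mono xf)/(_ (lexx _))/andP[d0 _] : 0 <= gamma^-1.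
  by rewrite invr_ge0 ltW.
have [->|d_neq0] := eqVneq (scaled_det h Q lambda gamma^-1 x) 0.
  by rewrite mulr0 le0_lneNy.
have d_gt0 : 0 < scaled_det h Q lambda gamma^-1 x by rewrite lt_def d_neq0.
rewrite !lne_EFin ?mulr_gt0 ?exprn_gt0 // lnM ?posrE ?exprn_gt0 // lnXn //.
by rewrite -EFinB mulr_natl addrC addKr.
Qed.

Lemma limit_objE x : feasible R n s x -> limit_obj h Q lambda x
  = ((2^-1)%:E * lne (scaled_det h Q lambda 0 x)%:E)%E.
Proof.
move=> xf; rewrite /limit_obj -/(lead_LPL h Q lambda x) /ldet scaled_det0.
rewrite -drsubmx_compl_P.
have := psd_det_ge0 (psd_lead_LPL xf).
have := psd_det_ge0 (psd_submx (psd_compl_P xf)).1.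
set a := \det (lead_LPL _ _ _ _); set b := \det (drsubmx _) => b0 a0.
congr (_ * _)%E.
have [->|a1] := eqVneq a 0; first by rewrite mul0r le0_lneNy.
have [->|b1] := eqVneq b 0.
  by rewrite mulr0 [lne 0%:E]le0_lneNy // addeNy.
have a_gt0 : 0 < a by rewrite lt_def a1.
have b_gt0 : 0 < b by rewrite lt_def b1.
by rewrite !lne_EFin ?mulr_gt0 // lnM ?posrE.
Qed.

Lemma lead_LPL_affine x y t : lead_LPL h Q lambda (t *: x + (1 - t) *: y)
  = t *: lead_LPL h Q lambda x + (1 - t) *: lead_LPL h Q lambda y.
Proof.
rewrite /lead_LPL /lead_submx !linearD !linearZ /= !(mulmxDl, mulmxDr) !linearD.
rewrite !(=^~ scalemxAl, =^~ scalemxAr, linearZ) /=.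
by rewrite !(=^~ scalemxAl, =^~ scalemxAr, linearZ, mulmxDl, mulmxDr).
Qed.

Lemma compl_P_affine x y t : compl_P h Q (t *: x + (1 - t) *: y)
  = t *: compl_P h Q x + (1 - t) *: compl_P h Q y.
Proof.
rewrite /compl_P; set P := fun x : 'rV_n => Q^T *m diag_mx x *m Q.
have -> : 1%:M - P (t *: x + (1 - t) *: y)
    = t *: (1%:M - P x) + (1 - t) *: (1%:M - P y).
  rewrite /P linearD !linearZ /= mulmxDr mulmxDl -!scalemxAr -!scalemxAl.
  rewrite !scalerBr addrACA -scalerDl [t + _]addrC subrK scale1r.
  by rewrite -opprD.
by rewrite linearD !linearZ.
Qed.

End Spectral.

(** * Convexity of the limit program *)

Lemma feasible_affine (R : realType) n s (x y : 'rV[R]_n) (t : R) :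
  feasible R n s x -> feasible R n s y -> 0 <= t <= 1 ->
  feasible R n s (t *: x + (1 - t) *: y).
Proof.
move=> [sx x01] [sy y01] /andP[t0 t1]; split=> [|i].
  under eq_bigr do rewrite !mxE.
  by rewrite big_split /= -!mulr_sumr sx sy -mulrDl addrC subrK mul1r.
rewrite !mxE; have /andP[x0 x1] := x01 i; have /andP[y0 y1] := y01 i.
have t'0 : 0 <= 1 - t by rewrite subr_ge0.
rewrite addr_ge0 ?mulr_ge0 //=.
have : t * x 0 i <= t * 1 by exact: ler_wpM2l.
have : (1 - t) * y 0 i <= (1 - t) * 1 by exact: ler_wpM2l.
move: (t * x 0 i) ((1 - t) * y 0 i) => a b; clear; lra.
Qed.

Lemma feasible_convex (R : realType) n s :
  @convex_set R 'rV[R]_n (feasible R n s).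
Proof.
move=> x y l; rewrite !inE => fx fy.
by apply: feasible_affine => //; exact/andP.
Qed.

(** Weights strictly between 0 and 1 make the left side -oo as soon as [a] or
    [b] vanishes, so the bound is only at stake when both are positive. *)
Lemma half_lne_concave (R : realType) (a b c t : R) :
  0 < t < 1 -> 0 <= a -> 0 <= b ->
  (0 < a -> 0 < b -> 0 < c /\ t * ln a + (1 - t) * ln b <= ln c) ->
  (t%:E * ((2^-1)%:E * lne a%:E) + (1 - t)%:E * ((2^-1)%:E * lne b%:E)
   <= (2^-1)%:E * lne c%:E)%E.
Proof.
move=> /andP[t0 t1] a0 b0 abc.
have [->|a1] := eqVneq a 0.
  rewrite [lne 0%:E]le0_lneNy // !gt0_muleNy ?lte_fin ?invr_gt0 //.
  by rewrite addNye leNye.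
have [->|b1] := eqVneq b 0.
  rewrite [lne 0%:E]le0_lneNy // !gt0_muleNy ?lte_fin ?invr_gt0 ?subr_gt0 //.
  by rewrite addeNy leNye.
have a_gt0 : 0 < a by rewrite lt_def a1.
have b_gt0 : 0 < b by rewrite lt_def b1.
have [c_gt0 le_c] := abc a_gt0 b_gt0.
by rewrite !lne_EFin // -!EFinM -EFinD lee_fin; clear abc; lra.
Qed.

Lemma limit_obj_concave (R : realType) n s (h : (s <= n)%N)
    (Q : 'M[R]_n) (lambda : 'rV[R]_n) :
  Q^T *m Q = 1%:M -> concave_on (feasible R n s) (limit_obj h Q lambda).
Proof.
move=> Q_orth x y t fx fy t01.
have [->|t_neq0] := eqVneq t 0.
  by rewrite mul0e add0e subr0 mul1e scale0r scale1r add0r.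
have [->|t_neq1] := eqVneq t 1.
  by rewrite subrr mul0e adde0 mul1e scale0r scale1r addr0.
have fz := feasible_affine fx fy t01.
have t01' : 0 < t < 1.
  by rewrite !lt_def t_neq0 eq_sym t_neq1.
rewrite !limit_objE //; apply: half_lne_concave => //.
- by have /andP[] := scaled_det_mono h lambda Q_orth fx (lexx 0) (lexx 0).
- by have /andP[] := scaled_det_mono h lambda Q_orth fy (lexx 0) (lexx 0).
rewrite !scaled_det0 -!drsubmx_compl_P lead_LPL_affine compl_P_affine.
have pLx := psd_lead_LPL h Q lambda fx; have pLy := psd_lead_LPL h Q lambda fy.
have [pRx _] := psd_submx (psd_compl_P h Q_orth fx).
have [pRy _] := psd_submx (psd_compl_P h Q_orth fy).
have pos (M N : R) : 0 <= M -> 0 <= N -> 0 < M * N -> 0 < M /\ 0 < N.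
  rewrite !le_eqVlt => /predU1P[<-|M0] /predU1P[<-|N0];
  by rewrite ?mulr0 ?mul0r ?ltxx.
move=> /(pos _ _ (psd_det_ge0 pLx) (psd_det_ge0 pRx))[Lx Rx].
move=> /(pos _ _ (psd_det_ge0 pLy) (psd_det_ge0 pRy))[Ly Ry].
have [Lz leL] := ln_det_concave t01' pLx pLy Lx Ly.
have [Rz leR] := ln_det_concave t01' pRx pRy Rx Ry.
have -> : drsubmx (t *: compl_P h Q x + (1 - t) *: compl_P h Q y)
    = t *: drsubmx (compl_P h Q x) + (1 - t) *: drsubmx (compl_P h Q y).
  by apply/matrixP => i j; rewrite !mxE.
split; first exact: mulr_gt0.
by rewrite !lnM ?posrE // !mulrDr addrACA lerD.
Qed.

(** * Continuity and compactness *)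

Section Cvg.
Context (R : realType) (T : Type) (F : set_system T) {FF : Filter F}.

Lemma cvg_bigsum (I : Type) (r : seq I) (P : pred I) (f : I -> T -> R)
    (l : I -> R) :
  (forall i, P i -> f i z @[z --> F] --> l i) ->
  \sum_(i <- r | P i) f i z @[z --> F] --> \sum_(i <- r | P i) l i.
Proof. by apply: cvg_big; exact: add_continuous. Qed.

Lemma cvg_bigprod (I : Type) (r : seq I) (P : pred I) (f : I -> T -> R)
    (l : I -> R) :
  (forall i, P i -> f i z @[z --> F] --> l i) ->
  \prod_(i <- r | P i) f i z @[z --> F] --> \prod_(i <- r | P i) l i.
Proof. by apply: cvg_big; exact: mul_continuous. Qed.

Lemma cvg_det n (M : T -> 'M[R]_n) (M0 : 'M[R]_n) :
  (forall i j, M z i j @[z --> F] --> M0 i j) ->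
  \det (M z) @[z --> F] --> \det M0.
Proof.
move=> MM0; rewrite /determinant; apply: cvg_bigsum => p _; apply: cvgM.
  exact: cvg_cst.
by apply: cvg_bigprod.
Qed.

Lemma cvg_det_pencil m n (A : T -> 'M[R]_m) (A0 : 'M[R]_m)
    (S : T -> 'M[R]_(m + n)) (S0 : 'M[R]_(m + n)) (t : T -> R) (t0 : R) :
  (forall i j, A z i j @[z --> F] --> A0 i j) ->
  (forall i j, S z i j @[z --> F] --> S0 i j) -> t z @[z --> F] --> t0 ->
  \det (pencil (A z) (S z) (t z)) @[z --> F] --> \det (pencil A0 S0 t0).
Proof.
move=> AA0 SS0 tt0; apply: cvg_det => i j; rewrite /pencil.
case: (split_ordP i) => i' ->; case: (split_ordP j) => j' ->.
- rewrite block_mxEul !mxE; under eq_cvg do rewrite block_mxEul !mxE.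
  by apply: cvgD; [|apply: cvgM].
- rewrite block_mxEur !mxE; under eq_cvg do rewrite block_mxEur !mxE.
  exact: cvgM.
- rewrite block_mxEdl !mxE; under eq_cvg do rewrite block_mxEdl !mxE.
  exact: SS0.
- rewrite block_mxEdr !mxE; under eq_cvg do rewrite block_mxEdr !mxE.
  exact: SS0.
Qed.

Lemma cvg_scaled_det n s (h : (s <= n)%N) (Q : 'M[R]_n) (lambda : 'rV[R]_n)
   (t : T -> R) (x : T -> 'rV[R]_n) (t0 : R) (x0 : 'rV[R]_n) :
  t z @[z --> F] --> t0 -> (forall i, x z 0 i @[z --> F] --> x0 0 i) ->
  scaled_det h Q lambda (t z) (x z) @[z --> F] --> scaled_det h Q lambda t0 x0.
Proof.
move=> tt0 xx0.
have PP i j : (Q^T *m diag_mx (x z) *m Q) i j @[z --> F]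
    --> (Q^T *m diag_mx x0 *m Q) i j.
  have E y : (Q^T *m diag_mx y *m Q) i j = \sum_k Q k i * y 0 k * Q k j.
    by rewrite mul_mx_diag mxE; apply: eq_bigr => k _; rewrite !mxE.
  rewrite E; under eq_cvg do rewrite E.
  by apply: cvg_bigsum => k _; apply: cvgM; [apply: cvgM|];
     [exact: cvg_cst| exact: xx0|exact: cvg_cst].
have LL i j : lead_LPL h Q lambda (x z) i j @[z --> F]
    --> lead_LPL h Q lambda x0 i j.
  rewrite lead_LPLE; under eq_cvg do rewrite lead_LPLE.
  by apply: cvgM; [apply: cvgM|]; [exact: cvg_cst|exact: PP|exact: cvg_cst].
have SS i j : compl_P h Q (x z) i j @[z --> F] --> compl_P h Q x0 i j.
  pose g := cast_ord (subnKC h).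
  have E y : compl_P h Q y i j
      = (1%:M : 'M[R]_n) (g i) (g j) - (Q^T *m diag_mx y *m Q) (g i) (g j).
    by rewrite /compl_P; move: (_ *m Q) => P; rewrite !mxE.
  rewrite E; under eq_cvg do rewrite E.
  by apply: cvgB; [exact: cvg_cst|exact: PP].
exact: cvg_det_pencil.
Qed.
End Cvg.

Section Compact.
Variables (R : realType) (n s : nat).

Lemma feasible_compact : compact (feasible R n s).
Proof.
have -> : feasible R n s =
    [set v : 'rV[R]_n | forall i, `[0, 1]%classic (v 0 i)]
    `&` (fun v : 'rV[R]_n => \sum_i v 0 i) @^-1` [set s%:R].
  apply/seteqP; split=> x [].
    by move=> sx x01; split=> // i; rewrite /= in_itv /=.
  by move=> x01 sx; split=> // i; have := x01 i; rewrite /= in_itv.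
apply: compact_closedI.
  by apply: (@rV_compact R n (fun=> `[0, 1]%classic)) => i;
     exact: segment_compact.
have /continuous_closedP : continuous (fun v : 'rV[R]_n => \sum_i v 0 i).
  by move=> v; apply: (cvg_bigsum (FF := nbhs_filter v)) => i _;
     exact: coord_continuous.
by apply; exact: closed_eq.
Qed.

Lemma feasible_center : (s <= n)%N -> (0 < n)%N ->
  feasible R n s (const_mx (s%:R / n%:R)).
Proof.
move=> sn n0; have n0' : 0 < n%:R :> R by rewrite ltr0n.
split=> [|i].
  under eq_bigr do rewrite mxE.
  by rewrite sumr_const card_ord -[LHS]mulr_natr divfK // gt_eqF.
by rewrite mxE divr_ge0 //= ler_pdivrMr // mul1r ler_nat.
Qed.
End Compact.

(** * Maxima and their limit *)

Section Linx.
Variables (R : realType) (n s : nat) (h : (s <= n)%N).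
Variables (C Q : 'M[R]_n) (lambda : 'rV[R]_n).
Hypotheses (s_gt0 : (0 < s)%N) (s_lt_n : (s < n)%N).
Hypotheses (Q_orth : Q^T *m Q = 1%:M) (C_spec : C = Q *m diag_mx lambda *m Q^T).
Hypothesis lambda_pos : forall i : 'I_n, (i < s)%N -> 0 < lambda 0 i.
Hypothesis lambda_zero : forall i : 'I_n, (s <= i)%N -> lambda 0 i = 0.

Let K := feasible R n s.
Let D := scaled_det h Q lambda.

(** At x = (s / n) e the matrix P is scalar, so that both determinants are
    explicit; 0 < s < n makes them positive. *)
Lemma scaled_det_center_gt0 : 0 < D 0 (const_mx (s%:R / n%:R)).
Proof.
have n0 : 0 < n%:R :> R by rewrite ltr0n (leq_trans _ h).
rewrite /D scaled_det0 /lead_LPL diag_const_mx mul_mx_scalar -scalemxAl Q_orth.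
set c := s%:R / n%:R.
have c0 : 0 < c by rewrite divr_gt0 // ltr0n.
have c1 : c < 1 by rewrite ltr_pdivrMr // mul1r ltr_nat.
have -> : lead_submx h (c *: 1%:M) = c%:M.
  by apply/matrixP => i j; rewrite !mxE mulr_natr.
have -> : trail_submx h (c *: 1%:M) = c%:M.
  apply/matrixP => i j; rewrite !mxE mulr_natr.
  by rewrite (inj_eq (@cast_ord_inj _ _ _)) (inj_eq (@rshift_inj _ _)).
rewrite -raddfB det_scalar !det_mulmx det_scalar !det_diag.
have L0 : 0 < \prod_i (colsub (widen_ord h) lambda) 0 i.
  by apply: prodr_gt0 => i _; rewrite mxE; apply: lambda_pos => /=.
by rewrite !mulr_gt0 ?exprn_gt0 // subr_gt0.
Qed.

Lemma scaled_det_max t : exists2 c, K c & forall x, K x -> D t x <= D t c.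
Proof.
have [||c /set_mem Kc cmax] :=
  @compact_EVT_max _ _ (D t) K _ (@feasible_compact R n s).
- exists (const_mx (s%:R / n%:R)).
  by apply: feasible_center => //; case: (n) s_lt_n.
- apply: continuous_subspaceT => x.
  by apply: (cvg_scaled_det (FF := nbhs_filter x)) => [|i];
     [exact: cvg_cst|exact: coord_continuous].
- by exists c => // x /mem_set; exact: cmax.
Qed.

Lemma le_half_lne (a b : R) : 0 <= a -> a <= b ->
  ((2^-1)%:E * lne a%:E <= (2^-1)%:E * lne b%:E)%E.
Proof.
move=> a0 ab; apply: lee_wpmul2l; first by rewrite lee_fin invr_ge0.
by rewrite lee_lne ?in_itv /= ?lee_fin ?leey // andbT (le_trans a0).
Qed.

(** The pointwise bound at t = 0 extends to a neighbourhood of each (x, 0) by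
    joint continuity, and compactness makes the range of t uniform in x. *)
Lemma near_scaled_det_lt (M : R) : (forall x, K x -> D 0 x < M) ->
  \forall gamma \near +oo, forall x, K x -> D gamma^-1 x < M.
Proof.
move=> DM.
have := (compact_near_coveringP K).1 (@feasible_compact R n s).
move=> /(_ _ (pinfty_nbhs R) (fun gamma x => D gamma^-1 x < M) _); apply=> x Kx.
have : D z.2^-1 z.1 @[z --> (nbhs x, pinfty_nbhs R)] --> D 0 x.
  apply: cvg_scaled_det => [|i].
    apply: (@cvg_comp _ _ _ snd (fun g : R => g^-1)); first exact: cvg_snd.
    apply/gtr0_cvgV0; last exact: cvg_id.
    exact: nbhs_pinfty_gt.
  apply: (@cvg_comp _ _ _ fst (fun y : 'rV[R]_n => y 0 i)).
    exact: cvg_fst.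
  exact: coord_continuous.
by move=> /cvgr_lt; apply; exact: DM.
Qed.

Let objE gamma x :=
  @linx_objE R n s h C Q lambda Q_orth C_spec lambda_zero gamma x.

Let limE x := @limit_objE R n s h Q lambda Q_orth x.

Lemma linx_is_max gamma : 0 < gamma ->
  is_max K (linx_obj C s gamma) (linx C s gamma).
Proof.
move=> g0; split; last exact: ereal_sup_ubound.
have [c Kc cmax] := scaled_det_max gamma^-1.
exists c => //; apply/eqP; rewrite eq_le; apply/andP; split.
  by apply: ereal_sup_ubound; exists c.
apply: ge_ereal_sup => _ [x Kx <-].
rewrite (objE Kx g0) (objE Kc g0); apply: le_half_lne; last exact: cmax.
have g0' : 0 <= gamma^-1 by rewrite invr_ge0 ltW.
by case/andP: (scaled_det_mono h lambda Q_orth Kx g0' (lexx _)).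
Qed.

Lemma linx_nonincreasing gamma1 gamma2 : 0 < gamma1 -> gamma1 <= gamma2 ->
  (linx C s gamma2 <= linx C s gamma1)%E.
Proof.
move=> g1 g12; have g2 : 0 < gamma2 by exact: lt_le_trans g12.
apply: ge_ereal_sup => _ [x Kx <-].
apply: le_trans (ereal_sup_ubound (ex_intro2 _ _ x Kx erefl)).
rewrite (objE Kx g1) (objE Kx g2).
have /andP[d0 d12] : 0 <= D gamma2^-1 x <= D gamma1^-1 x.
  by apply: scaled_det_mono => //; rewrite ?invr_ge0 ?lef_pV2 // ltW.
exact: le_half_lne.
Qed.

(** The squeeze v <= linx gamma <= v + e: the lower bound is monotonicity at a
    maximizer of the limit program, the upper bound is [near_scaled_det_lt] for
    the threshold exp (2 (v + e)). *)
Lemma linx_cvg : exists v : \bar R,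
  (linx C s gamma @[gamma --> +oo] --> v) /\ is_max K (limit_obj h Q lambda) v.
Proof.
have [c Kc cmax] := scaled_det_max 0.
have Dc : 0 < D 0 c.
  apply: (lt_le_trans scaled_det_center_gt0); apply: cmax.
  by apply: feasible_center => //; case: (n) s_lt_n.
have D0 t x : K x -> 0 <= t -> 0 <= D t x.
  by move=> Kx t0; case/andP: (scaled_det_mono h lambda Q_orth Kx t0 (lexx _)).
pose v : R := 2^-1 * ln (D 0 c).
have objc : limit_obj h Q lambda c = v%:E.
  by rewrite (limE Kc) -/D lne_EFin.
exists v%:E; split; last first.
  split; first by exists c.
  move=> _ [x Kx <-]; rewrite -objc (limE Kx) (limE Kc).
  by apply: le_half_lne; [exact: D0|exact: cmax].
have near_linx e : 0 < e ->
    \forall gamma \near +oo, (v%:E <= linx C s gamma <= (v + e)%:E)%E.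
  move=> e0; near=> gamma.
  have g0 : 0 < gamma by near: gamma; exact: nbhs_pinfty_gt.
  have g0' : 0 <= gamma^-1 by rewrite invr_ge0 ltW.
  apply/andP; split.
    apply: le_trans (ereal_sup_ubound (ex_intro2 _ _ c Kc erefl)).
    rewrite -objc (limE Kc) (objE Kc g0).
    apply: le_half_lne; first exact: D0.
    by case/andP: (scaled_det_mono h lambda Q_orth Kc (lexx 0) g0').
  apply: ge_ereal_sup => _ [x Kx <-]; rewrite (objE Kx g0).
  have -> : v + e = 2^-1 * ln (D 0 c * expR (2 * e)).
    by rewrite lnM ?posrE ?expR_gt0 // expRK mulrDr mulKf // pnatr_eq0.
  rewrite EFinM -lne_EFin ?mulr_gt0 ?expR_gt0 //.
  apply: le_half_lne; first exact: D0.
  apply/ltW; move: x Kx; near: gamma; apply: near_scaled_det_lt => x Kx.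
  apply: le_lt_trans (cmax _ Kx) _.
  by rewrite ltr_pMr // expR_gt1 mulr_gt0.
apply/fine_cvgP; split.
  near=> gamma; have /andP[l1 l2] : (v%:E <= linx C s gamma <= (v + 1)%:E)%E.
    by near: gamma; exact: near_linx.
  by rewrite fin_numE; move: l1 l2; case: (linx C s gamma).
apply/cvgrPdist_le => e e0; near=> gamma.
have : (v%:E <= linx C s gamma <= (v + e)%:E)%E.
  by near: gamma; exact: near_linx.
case E: (linx C s gamma) => [r| |] //=; rewrite ?leye_eq ?leeNy_eq ?andbF //.
rewrite E /= !lee_fin => /andP[l1 l2].
by rewrite distrC ger0_norm ?subr_ge0 // lerBlDl.
Unshelve. all: by end_near. Qed.
End Linx.

Theorem theorem3p8 (R : realType) (n s : nat) (C Q : 'M[R]_n)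
    (lambda : 'rV[R]_n)
    (s_gt0 : (0 < s)%N) (s_lt_n : (s < n)%N)
    (C_psd : possemidef C) (rankC : \rank C = s)
    (Q_orth : Q^T *m Q = 1%:M)
    (C_spec : C = Q *m diag_mx lambda *m Q^T)
    (lambda_sorted : forall i j : 'I_n, (i <= j)%N -> lambda 0 j <= lambda 0 i)
    (lambda_pos : forall i : 'I_n, (i < s)%N -> 0 < lambda 0 i)
    (lambda_zero : forall i : 'I_n, (s <= i)%N -> lambda 0 i = 0) :
  [/\ (* the maximum defining linx is attained *)
      forall gamma : R, 0 < gamma ->
        is_max (feasible R n s) (linx_obj C s gamma) (linx C s gamma),
      convex_program (feasible R n s) (limit_obj (ltnW s_lt_n) Q lambda),
      exists v : \bar R,
        (linx C s gamma @[gamma --> +oo] --> v) /\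
        is_max (feasible R n s) (limit_obj (ltnW s_lt_n) Q lambda) v
    & forall gamma1 gamma2 : R, 0 < gamma1 -> gamma1 <= gamma2 ->
        (linx C s gamma2 <= linx C s gamma1)%E].
Proof.
split.
- move=> gamma.
  exact: (linx_is_max (ltnW s_lt_n) s_lt_n Q_orth C_spec lambda_zero).
- split; [exact: feasible_convex|exact: limit_obj_concave].
- exact: (linx_cvg (ltnW s_lt_n) s_gt0 s_lt_n Q_orth C_spec).
- exact: (linx_nonincreasing (ltnW s_lt_n) Q_orth C_spec lambda_zero).
Qed.
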